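(* The greedy algorithm for the $(s,z,\ell)$-Strict Temporal Separator problem described in the context is an $(\ell-1)$-approximation algorithm: on every input $(G,s,z,\ell)$ it runs in polynomial time and returns an $(s,z,\ell)$-strict temporal separator $V'$ of $G$ with $|V'|\le(\ell-1)\,|V^*|$, where $V^*$ is a minimum-size $(s,z,\ell)$-strict temporal separator of $G$.
   Context: For an integer $n$, $[n]=\{1,\dots,n\}$. A temporal graph $G=(V,E,\tau)$ has a vertex set $V$ and a set $E\subseteq V\times V\times[\tau]$ of temporal edges $(u,v,t)$; edges are undirected, i.e. $(u,v,t)\in E$ iff $(v,u,t)\in E$. A strict temporal path from $s$ to $z$ is a sequence of temporal edges $P=[(u_1,v_1,t_1),\dots,(u_h,v_h,t_h)]$ with $u_1=s$, $v_h=z$, $v_i=u_{i+1}$ and $t_i<t_{i+1}$ for $i\in[h-1]$, the $u_i$ pairwise distinct and the $v_i$ pairwise distinct. Its travelling time is $t_h-t_1+1$, and $V(P)$ is its set of vertices. A strict $\ell$-temporal path is a strict temporal path of travelling time at most $\ell$. The $(s,z,\ell)$-Strict Temporal Separator problem: given a temporal graph $G=(V,E,\tau)$, distinct $s,z\in V$ and a positive integer $\ell\in[\tau]$, find a minimum-size $(s,z,\ell)$-strict temporal separator, i.e. a set $V'\subseteq V\setminus\{s,z\}$ such that $G[V\setminus V']$ contains no strict $\ell$-temporal path from $s$ to $z$. Instances are understood to admit a separator (equivalently, $s$ and $z$ share no temporal edge). The algorithm: start with $V'=\emptyset$. While there exists a strict $\ell$-temporal path $P$ from $s$ to $z$ in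 the current graph, pick one such $P$, add $V(P)\setminus\{s,z\}$ to $V'$, and remove $V(P)\setminus\{s,z\}$ from the graph. When no such path exists, return $V'$. *)

(* Defs.v *)
(* MathComp *)
From HB Require Import structures.
From mathcomp Require Import all_boot all_order all_algebra.
Set Implicit Arguments.
Unset Strict Implicit.
Unset Printing Implicit Defensive.

Section TemporalGraphs.
Variables (T : finType) (tau : nat).

(* The ordinal i : 'I_tau stands for the time label i + 1 of [tau] = {1..tau};
   see [etime]. *)
Definition tedge : Type := (T * T * 'I_tau)%type.
Definition esrc (e : tedge) : T := e.1.1.
Definition etgt (e : tedge) : T := e.1.2.
Definition etime (e : tedge) : nat := (e.2 : nat).+1.

(* The vertex set is a subset of an ambient finite type, so that subgraphs live
   in the same type as the graph. *)
Record tgraph := TGraph {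
  vset : {set T};
  eset : {set T * T * 'I_tau};
  eset_vset : forall u v t,
    (u, v, t) \in eset -> (u \in vset) && (v \in vset);
  eset_sym : forall u v t, ((u, v, t) \in eset) = ((v, u, t) \in eset)
}.

Section Induced.
Variables (G : tgraph) (U : {set T}).

Definition ind_vset : {set T} := vset G :&: U.
Definition ind_eset : {set T * T * 'I_tau} :=
  [set e in eset G | (esrc e \in U) && (etgt e \in U)].

Lemma ind_eset_vset u v t :
  (u, v, t) \in ind_eset -> (u \in ind_vset) && (v \in ind_vset).
Proof.
by rewrite !inE => /andP[/eset_vset/andP[-> ->]] /andP[-> ->].
Qed.

Lemma ind_eset_sym u v t :
  ((u, v, t) \in ind_eset) = ((v, u, t) \in ind_eset).
Proof. by rewrite !inE eset_sym /esrc /etgt /= [(u \in U) && _]andbC. Qed.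

(* G[U] *)
Definition induced : tgraph := TGraph ind_eset_vset ind_eset_sym.
End Induced.

(* G[V \ X] *)
Definition remove (G : tgraph) (X : {set T}) : tgraph :=
  induced G (vset G :\: X).

Definition consecutive (e f : tedge) : bool :=
  (etgt e == esrc f) && (etime e < etime f).

Definition strict_tpath (G : tgraph) (s z : T) (P : seq tedge) : bool :=
  if P is e :: P' then
    [&& all (fun f => f \in eset G) P,
        esrc e == s, etgt (last e P') == z,
        path consecutive e P',
        uniq (map esrc P) & uniq (map etgt P)]
  else false.

Definition travel_time (P : seq tedge) : nat :=
  if P is e :: P' then etime (last e P') - etime e + 1 else 0.

Definition strict_ltpath (l : nat) (G : tgraph) (s z : T) (P : seq tedge) :=
  strict_tpath G s z P && (travel_time P <= l).

Definition path_vset (P : seq tedge) : {set T} :=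
  [set x | (x \in map esrc P) || (x \in map etgt P)].

Definition separator (G : tgraph) (s z : T) (l : nat) (X : {set T}) : Prop :=
  X \subset vset G :\: [set s; z]
  /\ (forall P, ~~ strict_ltpath l (remove G X) s z P).

Definition min_separator (G : tgraph) (s z : T) (l : nat) (X : {set T}) :=
  separator G s z l X /\ (forall Y, separator G s z l Y -> #|X| <= #|Y|).

Definition instance (G : tgraph) (s z : T) (l : nat) : Prop :=
  [/\ s \in vset G, z \in vset G, s != z, 0 < l <= tau
    & exists X, separator G s z l X].

(* A configuration of the greedy algorithm is a pair (V', current graph).  The
   path is chosen nondeterministically, so the algorithm is a relation. *)
Definition config : Type := ({set T} * tgraph)%type.

Definition greedy_step (s z : T) (l : nat) (c c' : config) : Prop :=
  exists2 P, strict_ltpath l c.2 s z P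
           & let I := path_vset P :\: [set s; z] in
             c' = (c.1 :|: I, remove c.2 I).

Fixpoint greedy_steps (s z : T) (l k : nat) (c c' : config) : Prop :=
  if k is k'.+1 then
    exists2 c1, greedy_step s z l c c1 & greedy_steps s z l k' c1 c'
  else c = c'.

Definition greedy_returns (G : tgraph) (s z : T) (l : nat) (X : {set T}) :=
  exists k H, greedy_steps s z l k (set0, G) (X, H)
    /\ (forall P, ~~ strict_ltpath l H s z P).

(* Instances are presented as words of natural numbers: a vertex is named by its
   rank in T, and all vertices and all temporal edges are listed. *)
Definition code (v : T) : nat := enum_rank v.

Definition encode (G : tgraph) (s z : T) (l : nat) : seq nat :=
  [:: tau; l; code s; code z] ++
  #|vset G| :: map code (enum (vset G)) ++
  #|eset G| :: flatten [seq [:: code (esrc e); code (etgt e); etime e]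
                       | e : tedge <- enum (eset G)].

End TemporalGraphs.

(* Total number of binary digits; 0 has one digit. *)
Definition bitsize (w : seq nat) : nat := \sum_(x <- w) (trunc_log 2 x).+1.

(* Machine model: while programs on a random access memory made of finitely many
   (those named in the program) unbounded arrays of natural numbers.  A scalar
   variable is a cell at a constant index.  Every operation has unit cost; since
   there is no multiplication, t steps lengthen a number by O(t) bits, so that
   polynomial time in this model is polynomial time on Turing machines. *)
Inductive expr : Type :=
| Const of nat
| Get of nat & expr
| Add of expr & expr
| Sub of expr & expr
| Eq of expr & expr
| Lt of expr & expr.

Inductive com : Type :=
| Skip
| Set_ of nat & expr & expr
| Seq of com & com
| If of expr & com & com
| While of expr & com.

Definition memory : Type := nat -> nat -> nat.

Definition update (m : memory) (a i x : nat) : memory :=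
  fun b j => if (b == a) && (j == i) then x else m b j.

Fixpoint eval (m : memory) (e : expr) : nat :=
  match e with
  | Const n => n
  | Get a i => m a (eval m i)
  | Add e1 e2 => eval m e1 + eval m e2
  | Sub e1 e2 => eval m e1 - eval m e2
  | Eq e1 e2 => eval m e1 == eval m e2
  | Lt e1 e2 => eval m e1 < eval m e2
  end.

Fixpoint ecost (e : expr) : nat :=
  match e with
  | Const _ => 1
  | Get _ i => (ecost i).+1
  | Add e1 e2 | Sub e1 e2 | Eq e1 e2 | Lt e1 e2 => (ecost e1 + ecost e2).+1
  end.

(* [exec p m k m']: started in memory m, p halts after k steps in memory m'. *)
Inductive exec : com -> memory -> nat -> memory -> Prop :=
| ExecSkip m : exec Skip m 1 m
| ExecSet a i e m :
    exec (Set_ a i e) m (ecost i + ecost e).+1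
         (update m a (eval m i) (eval m e))
| ExecSeq p1 p2 m m1 m2 k1 k2 :
    exec p1 m k1 m1 -> exec p2 m1 k2 m2 -> exec (Seq p1 p2) m (k1 + k2) m2
| ExecIfTrue e p1 p2 m m' k :
    eval m e != 0 -> exec p1 m k m' -> exec (If e p1 p2) m (ecost e + k).+1 m'
| ExecIfFalse e p1 p2 m m' k :
    eval m e = 0 -> exec p2 m k m' -> exec (If e p1 p2) m (ecost e + k).+1 m'
| ExecWhileTrue e p m m1 m2 k1 k2 :
    eval m e != 0 -> exec p m k1 m1 -> exec (While e p) m1 k2 m2 ->
    exec (While e p) m (ecost e + k1 + k2).+1 m2
| ExecWhileFalse e p m :
    eval m e = 0 -> exec (While e p) m (ecost e).+1 m.

(* Array 0 initially holds the length of the input followed by the input, and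
   all other cells hold 0; the output is read off array 1 in the same format. *)
Definition init_memory (w : seq nat) : memory :=
  fun a i => if a == 0 then nth 0 (size w :: w) i else 0.

Definition output (m : memory) : seq nat := mkseq (fun i => m 1 i.+1) (m 1 0).

(* Main.v *)
Require Import Defs.
From mathcomp Require Import all_boot all_order all_algebra.
From mathcomp Require Import zify.

(* Every path picked by the greedy algorithm has at most l - 1 inner vertices,
   and the inner vertex sets of the successive paths are disjoint; as any
   separator meets each of them, k steps remove at most (l - 1) k vertices while
   k is at most the size of any separator.

   A strict l-temporal path starting at time t is found as in the Bellman-Ford
   algorithm: all edges are relaxed repeatedly on labels bounding the earliest
   arrival times below t + l of walks leaving s not before t.  Each label exceeds that of
   its predecessor, so backtracking from z gives a path that repeats no vertex.
   The program tries every edge time t as many times in a row as the input is long: more rounds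
   than there can be greedy steps, so one of them fails, and since removing
   vertices creates no path the search for t fails ever after. *)

Set Implicit Arguments.
Unset Strict Implicit.
Unset Printing Implicit Defensive.

(** * Greedy steps *)

Section Greedy.
Variables (T : finType) (tau : nat).
Implicit Types (G H : tgraph T tau) (s z v : T) (l : nat) (X Y : {set T}).
Implicit Types (e f : tedge T tau) (P : seq (tedge T tau)).

Lemma mem_eset_vset G e :
  e \in eset G -> (esrc e \in vset G) && (etgt e \in vset G).
Proof. by case: e => [[u v] t]; exact: eset_vset. Qed.

Lemma mem_eset_remove G X e :
  (e \in eset (remove G X))
  = [&& e \in eset G, esrc e \notin X & etgt e \notin X].
Proof.
rewrite !inE; case eG: (e \in eset G) => //=.
by case/andP: (mem_eset_vset eG) => -> ->; rewrite !andbT.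
Qed.

Lemma strict_ltpath_sub G H s z l P : {subset eset H <= eset G} ->
  strict_ltpath l H s z P -> strict_ltpath l G s z P.
Proof.
rewrite /strict_ltpath /strict_tpath; case: P => // e P sub.
by case/andP=> /andP[/(sub_all (fun f => sub f))-> ->] ->.
Qed.

Lemma strict_ltpath_eset H s z l P e :
  strict_ltpath l H s z P -> e \in P -> e \in eset H.
Proof. by case: P => // f P /andP[/andP[/allP edges _] _] /edges. Qed.

Lemma strict_ltpath_remove G X s z l P : strict_ltpath l G s z P ->
  [disjoint path_vset P & X] -> strict_ltpath l (remove G X) s z P.
Proof.
move=> ltP dis; have edges := strict_ltpath_eset ltP.
move: ltP; rewrite /strict_ltpath /strict_tpath.
case: P dis edges => // e P dis edges /andP[/andP[_ ->] ->]; rewrite !andbT.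
apply/allP=> f fP; rewrite mem_eset_remove edges //=.
by rewrite !(disjointFr dis) //= inE map_f ?orbT.
Qed.

(** The head of each edge is the tail of the next, so the heads are the tails shifted by one
    place. *)
Lemma map_etgt_path e P : path (@consecutive T tau) e P ->
  map (@etgt T tau) (e :: P)
  = rcons (map (@esrc T tau) P) (etgt (last e P)).
Proof.
elim: P e => //= f P IH e /andP[/andP[/eqP-> _] /IH].
by rewrite /= => ->.
Qed.

Lemma etime_last_path e P : path (@consecutive T tau) e P ->
  etime e + size P <= etime (last e P).
Proof.
elim: P e => [|f P IH] e /=; first by rewrite addn0.
case/andP=> /andP[_ lt_ef] /IH; apply: leq_trans.
by rewrite addnS -addSn leq_add2r.
Qed.

Definition interior s z P : {set T} := path_vset P :\: [set s; z].

Lemma interior_map s z e P : path (@consecutive T tau) e P ->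
  esrc e = s -> etgt (last e P) = z ->
  s \notin map (@esrc T tau) P -> z \notin map (@esrc T tau) P ->
  interior s z (e :: P) = [set x in map (@esrc T tau) P].
Proof.
move=> conP es ez sP zP; apply/setP=> x.
rewrite in_setD [x \in path_vset _]inE map_etgt_path // mem_rcons /= es ez !inE.
case: (x =P s) => [->|_]; first by rewrite (negPf sP).
by case: (x =P z) => [->|_]; rewrite ?(negPf zP) //= orbb.
Qed.

(** Inner vertices are tails of edges other than the first, and strictly increasing times leave room
    for at most [l] edges. *)
Lemma card_interior s z l H P :
  strict_ltpath l H s z P -> #|interior s z P| <= l - 1.
Proof.
case: P => // e P /andP[/and5P[_ /eqP es /eqP ez conP _] time].
apply: (@leq_trans (size P)).
  rewrite -(size_map (@esrc T tau)); apply: leq_trans (card_size _).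
  apply/subset_leq_card/subsetP=> x; rewrite in_setD [x \in path_vset _]inE.
  rewrite map_etgt_path // mem_rcons /= es ez !inE.
  by case: (x == s); case: (x == z) => //=; rewrite orbb.
rewrite leq_subRL; first last.
  by apply: leq_trans time; rewrite /= addn1.
apply: leq_trans time; rewrite /= addnC leq_add2r.
have le_time := etime_last_path conP.
by rewrite leq_subRL // (leq_trans _ le_time) ?leq_addr.
Qed.

(** A path avoiding [Y] survives in [remove G Y]; the common vertex is inner because [Y] contains
    neither [s] nor [z]. *)
Lemma separator_interior G s z l Y P : separator G s z l Y ->
  strict_ltpath l G s z P -> exists2 y, y \in Y & y \in interior s z P.
Proof.
case=> /subsetP sub /(_ P) noP ltP.
have [|] := boolP [disjoint path_vset P & Y].
  by move/(strict_ltpath_remove ltP)/(negP noP).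
case/pred0Pn=> y /andP[/= yP yY]; exists y => //.
by move/sub: yY; rewrite !inE in yP * => /andP[-> _].
Qed.

Lemma path_vset_avoid G H s z l X P x :
  (forall e, (e \in eset H)
     = [&& e \in eset G, esrc e \notin X & etgt e \notin X]) ->
  strict_ltpath l H s z P -> x \in path_vset P ->
  (x \in vset G) && (x \notin X).
Proof.
move=> edges ltP; rewrite inE => /orP[] /mapP[e /(strict_ltpath_eset ltP)];
  by rewrite edges => /and3P[/mem_eset_vset/andP[sG tG] sX tX] ->; apply/andP.
Qed.

(* [k] steps from [G] lead to [(X, H)], where [k] counts both the pairwise
   disjoint interiors that make up [X] and distinct vertices of any separator. *)
Definition greedy_inv G s z l k (c : config T tau) : Prop :=
  [/\ c.1 \subset vset G :\: [set s; z],
      forall e, (e \in eset c.2)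
        = [&& e \in eset G, esrc e \notin c.1 & etgt e \notin c.1],
      #|c.1| <= (l - 1) * k
    & forall Y, separator G s z l Y -> k <= #|Y :&: c.1|].

Lemma greedy_inv0 G s z l : greedy_inv G s z l 0 (set0, G).
Proof.
split=> //=; first exact: sub0set.
  by move=> e; rewrite !in_set0 !andbT.
by rewrite cards0.
Qed.

Lemma greedy_inv_step G s z l k c c' :
  greedy_inv G s z l k c -> greedy_step s z l c c' ->
  greedy_inv G s z l k.+1 c'.
Proof.
case: c => X H [/= subX edges cardX sepX] [P /= ltP ->].
have subHG : {subset eset H <= eset G} by move=> e; rewrite edges => /and3P[].
have inP x := @path_vset_avoid G H s z l X P x edges ltP.
split=> /=.
- rewrite subUset subX; apply/subsetP=> x; rewrite !in_setD.
  by case/andP=> -> /inP/andP[].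
- move=> e; rewrite mem_eset_remove edges !in_setU !negb_or -!andbA.
  by do !bool_congr.
- apply: leq_trans (leq_card_setU _ _) _.
  by rewrite mulnS addnC leq_add // (card_interior ltP).
(* [Y] meets the interior of [P] in some [y], which is not in [X] since [P] lies in the current
   graph; so the intersection grows strictly. *)
- move=> Y sepY; apply: leq_ltn_trans (sepX Y sepY) _.
  have [y yY yI] := separator_interior sepY (strict_ltpath_sub subHG ltP).
  apply/proper_card/properP; split; first by rewrite setIS // subsetUl.
  exists y; first by rewrite inE yY inE; rewrite yI orbT.
  move: yI; rewrite in_setD => /andP[_ /inP/andP[_ /negPf yX]].
  by rewrite inE yX andbF.
Qed.

Lemma greedy_inv_steps G s z l k c :
  greedy_steps s z l k (set0, G) c -> greedy_inv G s z l k c.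
Proof.
suff gen i k' c0 : greedy_inv G s z l i c0 -> greedy_steps s z l k' c0 c ->
    greedy_inv G s z l (i + k') c by exact: gen (greedy_inv0 _ _ _ _).
elim: k' i c0 => [|k' IH] i c0 inv /=; first by move=> <-; rewrite addn0.
by case=> c1 /(greedy_inv_step inv) inv1; rewrite addnS -addSn; exact: IH.
Qed.

Lemma greedy_steps_rcons s z l k (c c1 c2 : config T tau) :
  greedy_steps s z l k c c1 -> greedy_step s z l c1 c2 ->
  greedy_steps s z l k.+1 c c2.
Proof.
elim: k c => [|k IH] c /=; first by move=> -> st; exists c2.
by case=> c0 st sts st'; exists c0 => //; exact: IH sts st'.
Qed.

Lemma greedy_steps_bound G s z l k c : instance G s z l ->
  greedy_steps s z l k (set0, G) c -> k <= #|vset G|.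
Proof.
case=> _ _ _ _ [Y sepY] /greedy_inv_steps[subX _ _ /(_ Y sepY)].
move/leq_trans; apply; apply/subset_leq_card/(subset_trans (subsetIr _ _)).
exact: subset_trans subX (subsetDl _ _).
Qed.

Lemma greedy_returns_approx G s z l X : greedy_returns G s z l X ->
  separator G s z l X /\
  (forall Y, min_separator G s z l Y -> #|X| <= (l - 1) * #|Y|).
Proof.
case=> k [H [/greedy_inv_steps[/= subX edges cardX sepX] noP]]; split.
  split=> // P; apply: contra (noP P); apply: strict_ltpath_sub => e.
  by rewrite mem_eset_remove edges.
move=> Y [/sepX kY _]; apply: leq_trans cardX _.
by rewrite leq_mul2l (leq_trans kY) ?orbT // subset_leq_card ?subsetIl.
Qed.

End Greedy.

(** * Loop programs *)

(* [LFor c p] runs p with the cell (c, 0) ranging from 0 to N - 1, where N is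
   the length of the input. *)
Inductive loopcom : Type :=
| LSkip
| LSet of nat & expr & expr
| LSeq of loopcom & loopcom
| LIf of expr & loopcom & loopcom
| LFor of nat & loopcom.

Definition cell (a : nat) : expr := Get a (Const 0).
Definition incr (c : nat) : expr := Add (cell c) (Const 1).

Fixpoint compile (p : loopcom) : com :=
  match p with
  | LSkip => Skip
  | LSet a i e => Set_ a i e
  | LSeq p1 p2 => Seq (compile p1) (compile p2)
  | LIf e p1 p2 => If e (compile p1) (compile p2)
  | LFor c p => Seq (Set_ c (Const 0) (Const 0))
      (While (Lt (cell c) (cell 0))
         (Seq (compile p) (Set_ c (Const 0) (incr c))))
  end.

Fixpoint run (N : nat) (p : loopcom) (m : memory) : memory :=
  match p with
  | LSkip => m
  | LSet a i e => update m a (eval m i) (eval m e)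
  | LSeq p1 p2 => run N p2 (run N p1 m)
  | LIf e p1 p2 => if eval m e != 0 then run N p1 m else run N p2 m
  | LFor c p =>
      iter N (fun m => let m' := run N p m in update m' c 0 (eval m' (incr c)))
        (update m c 0 0)
  end.

Fixpoint written (p : loopcom) : seq nat :=
  match p with
  | LSkip => [::]
  | LSet a _ _ => [:: a]
  | LSeq p1 p2 | LIf _ p1 p2 => written p1 ++ written p2
  | LFor c p => c :: written p
  end.

(** Array 0 is never written, which preserves the input and the bound [N]; a body leaves its counter
    alone, so a loop makes exactly [N] rounds. *)
Fixpoint well_formed (p : loopcom) : bool :=
  match p with
  | LSkip => true
  | LSet a _ _ => a != 0
  | LSeq p1 p2 | LIf _ p1 p2 => well_formed p1 && well_formed p2
  | LFor c p => [&& c != 0, c \notin written p & well_formed p]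
  end.

(** An upper bound: a conditional pays for both branches. Each round of a loop adds 6 steps for the
    guard and 6 for the increment; resetting the counter takes 3 and the final test 6. *)
Fixpoint cost (p : loopcom) : {poly nat} :=
  match p with
  | LSkip => 1%:P
  | LSet _ i e => (ecost i + ecost e).+1%:P
  | LSeq p1 p2 => cost p1 + cost p2
  | LIf e p1 p2 => (ecost e).+1%:P + cost p1 + cost p2
  | LFor _ p => 'X * (cost p + 12%:P) + 9%:P
  end%R.

Lemma run_frame N p m b : b \notin written p -> run N p m b =1 m b.
Proof.
elim: p m => [|a i e|p1 IH1 p2 IH2|e p1 IH1 p2 IH2|c p IH] m /=.
- by [].
- by rewrite inE /update => /negPf-> j.
- by rewrite mem_cat negb_or => /andP[n1 n2] j; rewrite IH2 // IH1.
- by rewrite mem_cat negb_or => /andP[n1 n2] j; case: ifP; rewrite ?IH1 ?IH2.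
rewrite inE negb_or => /andP[/negPf bc bp] j.
set step := fun m => _; elim: {1}N => [|n IHn] /=; first by rewrite /update bc.
by rewrite /step /update bc /= IH.
Qed.

Lemma well_formed_written p : well_formed p -> 0 \notin written p.
Proof.
elim: p => //= [a _ _|p1 IH1 p2 IH2|e p1 IH1 p2 IH2|c p IH].
- by rewrite inE eq_sym.
- by case/andP=> /IH1 n1 /IH2 n2; rewrite mem_cat negb_or n1.
- by case/andP=> /IH1 n1 /IH2 n2; rewrite mem_cat negb_or n1.
- by case/and3P=> c0 _ /IH np; rewrite inE negb_or eq_sym c0.
Qed.

Lemma cost_for c p N :
  (cost (LFor c p)).[N]%R = N * ((cost p).[N]%R + 12) + 9.
Proof. by rewrite /= !(hornerD, hornerM, hornerX, hornerC). Qed.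

Lemma exec_run N p m : well_formed p -> m 0 0 = N ->
  exists2 k, exec (compile p) m k (run N p m) & k <= (cost p).[N]%R.
Proof.
elim: p m => [|a i e|p1 IH1 p2 IH2|e p1 IH1 p2 IH2|c p IH] m /= wf mN.
- by exists 1; rewrite ?hornerC //; constructor.
- by eexists; [constructor | rewrite hornerC].
- case/andP: wf => wf1 wf2; have [k1 e1 b1] := IH1 m wf1 mN.
  have [|k2 e2 b2] := IH2 (run N p1 m) wf2.
    by rewrite run_frame // well_formed_written.
  by exists (k1 + k2); [apply: ExecSeq e1 e2 | rewrite hornerD leq_add].
- case/andP: wf => wf1 wf2; rewrite !hornerD hornerC.
  case: ifP => [e0|/negbFE/eqP e0].
    have [k1 e1 b1] := IH1 m wf1 mN.
    exists (ecost e + k1).+1; first exact: ExecIfTrue.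
    by rewrite -addSn (leq_trans _ (leq_addr _ _)) // leq_add2l.
  have [k2 e2 b2] := IH2 m wf2 mN.
  exists (ecost e + k2).+1; first exact: ExecIfFalse.
  by rewrite -addSn leq_add // leq_addr.
case/and3P: wf => c0 cp wf.
rewrite -/(cost (LFor c p)) cost_for; set step := (fun _ => update _ _ _ _).
set guard := Lt _ _; set body := Seq (compile p) _.
have loop n m1 : m1 0 0 = N -> m1 c 0 + n = N ->
    exists2 k, exec (While guard body) m1 k (iter n step m1)
             & k <= n * ((cost p).[N]%R + 12) + 6.
  elim: n m1 => [|n IHn] m1 m1N cN.
    exists (ecost guard).+1 => //; apply: ExecWhileFalse.
    by rewrite /= m1N -cN addn0 ltnn.
  have [k1 e1 b1] := IH m1 wf m1N.
  have m2c : run N p m1 c 0 = m1 c 0 by rewrite run_frame.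
  have m2N : run N p m1 0 0 = N by rewrite run_frame // well_formed_written.
  rewrite iterSr; have [||k2 e2 b2] := IHn (step m1).
  - by rewrite /step /update eq_sym (negPf c0).
  - by rewrite /step /update !eqxx /= m2c addn1 addSnnS.
  exists (ecost guard + (k1 + 6) + k2).+1; last by rewrite /= mulSn; lia.
  apply: ExecWhileTrue (ExecSeq e1 (ExecSet _ _ _ _)) e2.
  by rewrite /= m1N -cN addnS ltnS leq_addr.
have [||k e1 b1] := loop N (update m c 0 0).
- by rewrite /update eq_sym (negPf c0).
- by rewrite /update !eqxx.
exists (3 + k); first by apply: (ExecSeq (ExecSet _ _ _ _)); exact: e1.
by rewrite addnC -[9]/(6 + 3) addnA leq_add2r.
Qed.

Lemma run_for_ind N c p m (I : nat -> memory -> Prop) :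
  c \notin written p -> I 0 (update m c 0 0) ->
  (forall j m', j < N -> m' c 0 = j -> I j m' ->
     I j.+1 (update (run N p m') c 0 j.+1)) ->
  I N (run N (LFor c p) m).
Proof.
move=> cp I0 IS /=; set step := fun m => _.
suff: forall n, n <= N ->
    I n (iter n step (update m c 0 0)) /\ iter n step (update m c 0 0) c 0 = n.
  by move/(_ N (leqnn N)) => [].
elim=> [|n IHn] ltnN /=; first by rewrite /update !eqxx.
have [In cn] := IHn (ltnW ltnN).
have -> : step (iter n step (update m c 0 0))
    = update (run N p (iter n step (update m c 0 0))) c 0 n.+1.
  by rewrite /step /= run_frame // cn addn1.
by split; [exact: IS | rewrite /update !eqxx].
Qed.

Lemma run_seq N p1 p2 m : run N (LSeq p1 p2) m = run N p2 (run N p1 m).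
Proof. by []. Qed.

Lemma run_set N a i e m :
  run N (LSet a i e) m = update m a (eval m i) (eval m e).
Proof. by []. Qed.

Lemma run_if N e p1 p2 m :
  run N (LIf e p1 p2) m = if eval m e != 0 then run N p1 m else run N p2 m.
Proof. by []. Qed.

Arguments run : simpl never.

Lemma size_bitsize w : size w <= bitsize w.
Proof.
rewrite /bitsize -sum1_size; elim: w => [|x w IH]; first by rewrite !big_nil.
by rewrite !big_cons leq_add.
Qed.

(** Monotonicity turns a time bound in the input length into one in the bit size, which is no
    smaller by [size_bitsize]. *)
Lemma leq_cost p : {homo (fun n => (cost p).[n]%R) : m n / m <= n}.
Proof.
move=> m n le_mn; elim: p => [|a i e|p1 IH1 p2 IH2|e p1 IH1 p2 IH2|c p IH] /=.
- by rewrite !hornerC.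
- by rewrite !hornerC.
- by rewrite !hornerD leq_add.
- by rewrite !hornerD !hornerC !leq_add.
- by rewrite -!/(cost (LFor c p)) !cost_for leq_add2r leq_mul // leq_add2r.
Qed.

(** * The greedy program *)

(* Arrays besides input and output: 2 = arrival labels, 3 = predecessors,
   4 = removed vertices, 5 = current vertex of the backtracking, 6 .. 11 = loop
   counters. *)
Definition in_l : expr := Get 0 (Const 2).
Definition in_s : expr := Get 0 (Const 3).
Definition in_z : expr := Get 0 (Const 4).

(* The j-th edge occupies cells 7 + n + 3 j, ... of array 0, where n is the
   number of vertices, kept in cell 5; reading past the last edge yields 0. *)
Definition edge_field (f c : nat) : expr :=
  Get 0 (Add (Add (Get 0 (Const 5)) (Const f))
             (Add (Add (cell c) (cell c)) (cell c))).

Definition horizon : expr := Add (edge_field 9 6) in_l.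

(** The sum of four truth values exceeds 3 exactly when all hold, which expresses a conjunction:
    neither endpoint is removed, the edge leaves [u] after the label of [u], and it improves the
    label of [v]. *)
Definition relax : loopcom :=
  let u := edge_field 7 10 in
  let v := edge_field 8 10 in
  let t := edge_field 9 10 in
  LIf (Lt (Const 3)
         (Add (Add (Eq (Get 4 u) (Const 0)) (Eq (Get 4 v) (Const 0)))
              (Add (Lt (Get 2 u) t) (Lt t (Get 2 v)))))
      (LSeq (LSet 2 v t) (LSet 3 v u))
      LSkip.

(* Looping over all numbers of the input covers in particular every vertex. *)
Definition initialize : loopcom :=
  LSeq (LFor 8 (LSet 2 (Get 0 (incr 8)) horizon))
       (LSet 2 in_s (Defs.Sub (edge_field 9 6) (Const 1))).

(** Starting at the predecessor of [z] keeps [z] itself out of the output. The number of rounds is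
    fixed, so those left after reaching [s] idle. *)
Definition backtrack : loopcom :=
  LSeq (LSet 5 (Const 0) (Get 3 in_z))
       (LFor 11
         (LIf (Eq (cell 5) in_s) LSkip
           (LSeq (LSet 1 (Const 0) (incr 1))
           (LSeq (LSet 1 (cell 1) (cell 5))
           (LSeq (LSet 4 (cell 5) (Const 1))
                 (LSet 5 (Const 0) (Get 3 (cell 5)))))))).

Definition search : loopcom := LSeq initialize (LFor 9 (LFor 10 relax)).

Definition attempt : loopcom :=
  LSeq search (LIf (Lt (Get 2 in_z) horizon) backtrack LSkip).

Definition greedy : loopcom := LFor 6 (LFor 7 attempt).

Lemma code_inj (T : finType) : injective (@code T).
Proof. by move=> u v /ord_inj/enum_rank_inj. Qed.

Lemma nth_triples (A : Type) (f g h : A -> nat) (r : seq A) x0 j :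
  let w := flatten [seq [:: f x; g x; h x] | x <- r] in
  let at_ k := nth 0 w (k + (j + j + j)) in
  (at_ 0, at_ 1, at_ 2) = if j < size r
    then let x := nth x0 r j in (f x, g x, h x) else (0, 0, 0).
Proof.
move=> /=; elim: r j => [|x r IH] [|j] /=; rewrite ?nth_nil //.
by rewrite !(addnS, addSn) /= IH.
Qed.

Lemma output_rcons m y :
  output (update (update m 1 0 (m 1 0 + 1)) 1 (m 1 0 + 1) y)
  = rcons (output m) y.
Proof.
rewrite /output [update _ 1 _ y 1 0]/update addn1 /=.
rewrite [update _ _ _ _ 1 0]/update /=.
rewrite mkseqS; congr rcons; last by rewrite /update !eqxx.
apply/eq_in_map => i; rewrite mem_iota /= add0n /update => lti.
by rewrite /= eqSS (ltn_eqF lti).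
Qed.

(** * Layout of the encoded instance *)

Section Correctness.
Variables (T : finType) (tau : nat) (G : tgraph T tau) (s z : T) (l : nat).
Implicit Types (H : tgraph T tau) (X : {set T}) (u v : T).
Implicit Types (e f : tedge T tau) (P : seq (tedge T tau)) (m : memory).

Let w := encode G s z l.
Let N := size w.

Definition holds_input m := m 0 =1 nth 0 (size w :: w).

Definition edge_at (j : nat) e :=
  let field i := nth 0 (size w :: w) (#|vset G| + i + (j + j + j)) in
  [/\ field 7 = code (esrc e), field 8 = code (etgt e) & field 9 = etime e].

Lemma nth_edges j i : nth 0 (size w :: w) (#|vset G| + i.+3.+4 + (j + j + j))
  = nth 0 (flatten [seq [:: code (esrc e); code (etgt e); etime e]
                    | e : tedge T tau <- enum (eset G)]) (i + (j + j + j)).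
Proof.
rewrite -addnA addnC !addSn /w /encode /= nth_cat size_map -cardE.
by rewrite -addSn ltnNge leq_addl /= addnK.
Qed.

Lemma size_encode : N = #|vset G| + 6 + 3 * #|eset G|.
Proof.
rewrite /N /w /encode /= size_cat /= size_map -cardE size_flatten.
rewrite /shape -map_comp sumnE big_map (eq_bigr (fun=> 3)) //.
by rewrite big_const_seq count_predT iter_addn_0 -cardE addnAC !addnS addn0.
Qed.

Lemma mem_edge_at e : e \in eset G -> exists2 j, j < N & edge_at j e.
Proof.
move=> eG; have eE : e \in enum (eset G) by rewrite mem_enum.
have lt_j : index e (enum (eset G)) < size (enum (eset G)) by rewrite index_mem.
exists (index e (enum (eset G))).
  by rewrite size_encode; move: lt_j; rewrite -cardE; lia.
have := nth_triples (fun e => code (esrc e)) (fun e => code (etgt e))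
  (@etime T tau) (enum (eset G)) e (index e (enum (eset G))).
by rewrite /= lt_j nth_index // /edge_at !nth_edges => -[-> -> ->].
Qed.

(** Times of edges are at least 1, so the value 0 read past the last edge marks an index that names
    no edge. *)
Lemma edge_atP j : nth 0 (size w :: w) (#|vset G| + 9 + (j + j + j)) = 0 \/
  exists2 e, e \in eset G & edge_at j e.
Proof.
have nthE e := nth_triples (fun e => code (esrc e)) (fun e => code (etgt e))
  (@etime T tau) (enum (eset G)) e j.
case: (ltnP j (size (enum (eset G)))) => [lt_j|ge_j]; [right | left].
  have [e _] : exists e, e \in enum (eset G).
    by case: (enum (eset G)) lt_j => // e r _; exists e; exact: mem_head.
  exists (nth e (enum (eset G)) j); first by rewrite -mem_enum mem_nth.
  by have := nthE e; rewrite /= lt_j /edge_at !nth_edges => -[-> -> ->].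
rewrite nth_edges; case E: (enum (eset G)) => [|e r]; first by rewrite nth_nil.
by have := nthE e; rewrite /= ltnNge ge_j E => -[_ _ ->].
Qed.

Lemma mem_vertex v : v \in vset G ->
  exists2 j, j < N & nth 0 (size w :: w) j.+1 = code v.
Proof.
rewrite -mem_enum => vE.
have lt_j : index v (enum (vset G)) < size (enum (vset G)) by rewrite index_mem.
(* Cells 1 to 5 hold [tau], [l], [s], [z] and the number of vertices; the vertices start at cell
   6. *)
exists (5 + index v (enum (vset G))).
  by rewrite size_encode; move: lt_j; rewrite -cardE; lia.
rewrite /w /encode /= nth_cat size_map lt_j (nth_map v) //.
by rewrite nth_index.
Qed.

Lemma eval_edge_field m i c : holds_input m ->
  eval m (edge_field i c)
  = nth 0 (size w :: w) (#|vset G| + i + (m c 0 + m c 0 + m c 0)).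
Proof. by move=> in_m; rewrite /= !in_m. Qed.

Lemma eval_horizon m : holds_input m -> eval m horizon
  = nth 0 (size w :: w) (#|vset G| + 9 + (m 6 0 + m 6 0 + m 6 0)) + l.
Proof.
move=> in_m; rewrite -[LHS]/(eval m (edge_field 9 6) + m 0 2).
by rewrite eval_edge_field // in_m.
Qed.

(** * Arrival labels and their relaxation *)

Section Labels.
Variables (H : tgraph T tau) (t : nat).
Hypothesis HG : {subset eset H <= eset G}.

(* a holds arrival times of walks leaving s at time t or later, t + l standing
   for "not reached", and p their last but one vertices. *)
Definition labelling (a p : nat -> nat) : Prop :=
  [/\ a (code s) = t - 1,
      forall v, v \in vset G -> t - 1 <= a (code v) <= t + l
    & forall v, v \in vset G -> v != s -> a (code v) < t + l ->
        exists2 e, e \in eset H &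
        [/\ etgt e = v, p (code v) = code (esrc e), etime e = a (code v)
          & a (code (esrc e)) < etime e]].

(* Labels decrease strictly along predecessors, so that backtracking them
   yields a path without repeated vertices. *)
Lemma labelling_path a p v : labelling a p ->
  v \in vset G -> v != s -> a (code v) < t + l ->
  exists e P,
  [/\ [/\ esrc e = s, etgt (last e P) = v, path (@consecutive T tau) e P
        & t <= etime e],
      forall f, f \in e :: P -> f \in eset H /\ etime f = a (code (etgt f))
    & path (fun x y => p (code x) == code y) v
        (rev (map (@esrc T tau) (e :: P)))].
Proof.
case=> as_ le_a pred; have [b] := ubnP (a (code v)).
elim: b v => // b IH v lt_ab vG vs lt_av.
have [f fH [fv pv tf lt_f]] := pred v vG vs lt_av.
have /andP[uG _] := mem_eset_vset (HG fH).
have [us|us] := eqVneq (esrc f) s.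
  exists f, [::]; split=> //=; first split=> //.
  - by move: lt_f; rewrite us as_; lia.
  - by move=> g; rewrite inE => /eqP->; rewrite fv -tf.
  - by rewrite pv eqxx.
have [||e [P [[es lastP conP te] inH chain]]] := IH (esrc f) _ uG us.
- by move: lt_ab; rewrite -tf ltnS; apply: leq_trans.
- by rewrite (ltn_trans lt_f) // tf.
exists e, (rcons P f); split.
- split=> //; first by rewrite last_rcons.
  rewrite rcons_path conP /= /consecutive lastP eqxx /=.
  by have [_ ->] := inH _ (mem_last e P); rewrite lastP.
- move=> g; rewrite -rcons_cons mem_rcons inE => /orP[/eqP->|/inH //].
  by rewrite fv -tf.
- by rewrite -rcons_cons map_rcons rev_rcons /= pv eqxx.
Qed.

(** Edge times are the labels of the heads and increase along the path, so the heads are distinct.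
    The first edge leaves at [t] or later and the last arrives before [t + l], which bounds the
    travelling time. [Q] lists the inner vertices from [z] back to [s], in the order of
    backtracking. *)
Lemma labelling_ltpath a p : labelling a p -> z \in vset G -> s != z ->
  a (code z) < t + l ->
  exists P Q,
  [/\ strict_ltpath l H s z P, interior s z P = [set x in Q], uniq Q,
      s \notin Q & path (fun x y => p (code x) == code y) z (rcons Q s)].
Proof.
move=> lab zG sz lt_z; have zs : z != s by rewrite eq_sym.
have [e [P [[es ez conP te] inH chain]]] := labelling_path lab zG zs lt_z.
have [as_ _ _] := lab.
have tgtE := map_etgt_path conP.
have uniq_tgt : uniq (map (@etgt T tau) (e :: P)).
  apply: (@map_uniq _ _ (fun v => a (code v))); rewrite -map_comp.
  have -> : map ((fun v => a (code v)) \o (@etgt T tau)) (e :: P)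
      = map (@etime T tau) (e :: P).
    by apply/eq_in_map=> f fP; have [_ ->] := inH f fP.
  apply: (sorted_uniq ltn_trans ltnn); rewrite sorted_map.
  by apply: sub_path conP => f g /andP[].
have late : forall f, f \in e :: P -> t <= etime f.
  move=> f fP; apply: leq_trans te _.
  have : path ltn (etime e) (map (@etime T tau) P).
    by rewrite path_map; apply: sub_path conP => g h /andP[].
  move/(order_path_min ltn_trans)/allP => lt_e.
  by move: fP; rewrite inE => /orP[/eqP->|/(map_f (@etime T tau))/lt_e/ltnW].
(* Otherwise some edge would enter [s] at its label [t - 1]; but edge times here are at least [t]
   and also at least 1, which settles [t = 0]. *)
have sP : s \notin map (@esrc T tau) P.
  apply/negP=> sP.
  have : s \in map (@etgt T tau) (e :: P) by rewrite tgtE mem_rcons inE sP orbT.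
  case/mapP=> f fP sf; have [_ tf] := inH f fP.
  by move: (late f fP) tf; rewrite -sf as_ /etime; lia.
move: uniq_tgt; rewrite tgtE ez rcons_uniq => /andP[zP uniqP].
exists (e :: P), (rev (map (@esrc T tau) P)); split.
- apply/andP; split.
    rewrite /strict_tpath es ez !eqxx conP tgtE ez rcons_uniq zP uniqP /= es sP.
    rewrite uniqP !andbT -[_ && _]/(all _ (e :: P)).
    by apply/allP=> f fP; case: (inH f fP).
  rewrite /travel_time; have [_ tl] := inH _ (mem_last e P).
  by move: lt_z te (late _ (mem_last e P)); rewrite tl ez; lia.
- by rewrite interior_map //; apply/setP=> x; rewrite !inE mem_rev.
- by rewrite rev_uniq.
- by rewrite mem_rev.
- by move: chain; rewrite /= rev_cons es.
Qed.

(** Lowering one label keeps the predecessor condition at the other vertices, which only bounds the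
    labels of predecessors from above. The guard rejects loops at a vertex, and edges into [s],
    whose label is least. *)
Lemma relax_spec X m j : holds_input m ->
  (forall v, m 4 (code v) = (v \in X)) ->
  (forall e, e \in eset H
     = [&& e \in eset G, esrc e \notin X & etgt e \notin X]) ->
  m 10 0 = j -> labelling (m 2) (m 3) ->
  let m' := run N relax m in
  [/\ labelling (m' 2) (m' 3),
      forall v, m' 2 (code v) <= m 2 (code v)
    & forall e, e \in eset H -> edge_at j e -> m 2 (code (esrc e)) < etime e ->
        m' 2 (code (etgt e)) <= etime e].
Proof.
move=> in_m del edges mj lab m'.
set u := edge_field 7 10; set v := edge_field 8 10; set t' := edge_field 9 10.
pose guard := Lt (Const 3)
  (Add (Add (Eq (Get 4 u) (Const 0)) (Eq (Get 4 v) (Const 0)))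
       (Add (Lt (Get 2 u) t') (Lt t' (Get 2 v)))).
have m'E : m' = if eval m guard != 0
    then run N (LSeq (LSet 2 v t') (LSet 3 v u)) m else m by [].
have E i : eval m (edge_field i 10)
    = nth 0 (size w :: w) (#|vset G| + i + (j + j + j)).
  by rewrite eval_edge_field // mj.
have guardE : (eval m guard != 0)
   = [&& m 4 (eval m u) == 0, m 4 (eval m v) == 0,
         m 2 (eval m u) < eval m t' & eval m t' < m 2 (eval m v)].
  rewrite {1}/guard [eval m (Lt _ _)]/= -/(eval m u) -/(eval m v) -/(eval m t').
  have conj4 (b1 b2 b3 b4 : bool) :
    ((3 < b1 + b2 + (b3 + b4) : nat) != 0) = [&& b1, b2, b3 & b4].
  by case: b1; case: b2; case: b3; case: b4.
  exact: conj4.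
rewrite guardE in m'E; clearbody m'.
case: ifP m'E => [/and4P[du dv lt_u lt_v]|noguard] m'E; last first.
  rewrite m'E; split=> // e eH [ue ve te] lt_e.
  rewrite leqNgt; apply/negP=> lt_t.
  have:= eH; rewrite edges => /and3P[_ su tu].
  by move: noguard; rewrite !E ue ve te !del (negPf su) (negPf tu) lt_e lt_t.
have [t0|[e eG [ue ve te]]] := edge_atP j.
  by move: lt_u; rewrite (E 9) t0.
have uE : eval m u = code (esrc e) by rewrite E.
have vE : eval m v = code (etgt e) by rewrite E.
have tE : eval m t' = etime e by rewrite E.
have m2 x : m' 2 x = if x == code (etgt e) then etime e else m 2 x.
  by rewrite m'E -vE -tE.
have m3 x : m' 3 x = if x == code (etgt e) then code (esrc e) else m 3 x.
  by rewrite m'E -vE -uE.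
rewrite uE vE tE in du dv lt_u lt_v.
have eH : e \in eset H.
  rewrite edges eG; move: du dv; rewrite !del.
  by case: (esrc e \in X); case: (etgt e \in X).
have mono v0 : m' 2 (code v0) <= m 2 (code v0).
  by rewrite m2; case: eqP => [->|//]; exact: ltnW.
have /andP[uG vG] := mem_eset_vset eG.
have [as_ le_a pred] := lab.
have ts : etgt e != s.
  apply/eqP=> ts; move: lt_u lt_v (le_a _ uG); rewrite ts as_; lia.
split=> //.
- split.
  + by rewrite m2 (inj_eq (@code_inj T)) eq_sym (negPf ts).
  + move=> v0 v0G; rewrite m2; case: eqP => _; last exact: le_a.
    by move: lt_u lt_v (le_a _ uG) (le_a _ vG); lia.
  + move=> v0 v0G v0s; rewrite m3 m2 (inj_eq (@code_inj T)).
    case: (v0 =P etgt e) => [-> _|_ /(pred v0 v0G v0s)[f fH [fv pf tf lt_f]]].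
      exists e => //; split=> //.
      rewrite m2; case: eqP => // uv; move: lt_u lt_v; rewrite uv; lia.
    by exists f => //; split=> //; exact: leq_ltn_trans (mono _) lt_f.
- move=> f fH [uf vf tf] lt_f; rewrite m2 -vf ve eqxx.
  by rewrite -te tf.
Qed.

(** The Bellman-Ford invariant after [k] rounds; the walk [e :: P] has at most [k] edges. *)
Definition reached_by (k : nat) (a : nat -> nat) : Prop :=
  forall e P, esrc e = s -> t <= etime e -> {subset e :: P <= eset H} ->
    path (@consecutive T tau) e P -> size P < k ->
    a (code (etgt (last e P))) <= etime (last e P).

Definition holds_removed X m := forall v, m 4 (code v) = (v \in X).

(** Before the round, the tail of the last edge of a walk has a label below the time of that edge:
    by [reached_by k], or because the tail is [s] with label [t - 1]. Relaxing the edge then bounds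
    the label of its head. *)
Lemma relax_loop_spec X m k : holds_input m -> holds_removed X m ->
  (forall e, e \in eset H
     = [&& e \in eset G, esrc e \notin X & etgt e \notin X]) ->
  labelling (m 2) (m 3) -> reached_by k (m 2) ->
  let m' := run N (LFor 10 relax) m in
  labelling (m' 2) (m' 3) /\ reached_by k.+1 (m' 2).
Proof.
move=> in_m del edges lab reach m'.
(* Labels are compared with those before the round: updates during it only lower them, so the tail
   label stays small enough until its edge is treated. *)
pose I j m' := [/\ holds_input m', holds_removed X m',
  labelling (m' 2) (m' 3), forall v, m' 2 (code v) <= m 2 (code v)
  & forall i e, i < j -> e \in eset H -> edge_at i e ->
      m 2 (code (esrc e)) < etime e -> m' 2 (code (etgt e)) <= etime e].
have [_ _ lab' mono relaxed] : I N m'.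
  rewrite /m'; apply: run_for_ind => // j m1 ltj m1j.
  case=> in1 del1 lab1 mono1 relaxed1.
  have [lab2 mono2 relaxed2] := relax_spec in1 del1 edges m1j lab1.
  split=> //.
  - by move=> x; rewrite -in1 -(run_frame (p := relax) N m1).
  - by move=> v; rewrite -del1 -(run_frame (p := relax) N m1).
  - by move=> v; apply: leq_trans (mono2 v) (mono1 v).
  - move=> i e; rewrite ltnS leq_eqVlt => /orP[/eqP->|ltij] eH e_at lt_e.
      exact: relaxed2 (leq_ltn_trans (mono1 _) lt_e).
    exact: leq_trans (mono2 _) (relaxed1 i e ltij eH e_at lt_e).
clearbody m'; split=> // e P; case/lastP: P => [|P f] es te sub /= conP sizeP.
  have eH : e \in eset H by apply: sub; exact: mem_head.
  have [j ltj e_at] := mem_edge_at (HG eH).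
  apply: (relaxed j) => //; rewrite es; have [-> _ _] := lab.
  by rewrite /etime; move: te; rewrite /etime; lia.
rewrite last_rcons.
move: conP; rewrite rcons_path => /andP[conP /andP[/eqP ef lt_ef]].
have fH : f \in eset H by apply: sub; rewrite -rcons_cons mem_rcons mem_head.
have [j ltj f_at] := mem_edge_at (HG fH).
apply: (relaxed j) => //; rewrite -ef; apply: leq_ltn_trans lt_ef.
apply: reach => //; last by rewrite size_rcons in sizeP.
by move=> g gP; apply: sub; rewrite -rcons_cons mem_rcons inE gP orbT.
Qed.

Lemma initialize_spec m : s \in vset G -> holds_input m ->
  nth 0 (size w :: w) (#|vset G| + 9 + (m 6 0 + m 6 0 + m 6 0)) = t ->
  let m' := run N initialize m in labelling (m' 2) (m' 3).
Proof.
move=> sG in_m mt m'.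
pose I j m' := [/\ holds_input m', m' 6 0 = m 6 0
  & forall i, i < j -> m' 2 (nth 0 (size w :: w) i.+1) = t + l].
set loop := LFor 8 (LSet 2 (Get 0 (incr 8)) horizon).
have [in1 m16 init] : I N (run N loop m).
  apply: run_for_ind => // j m1 ltj m1j [in1 m16 init1]; split=> // i lti.
  have tlE : eval m1 horizon = t + l.
    by rewrite eval_horizon // m16 mt.
  have -> : update (run N (LSet 2 (Get 0 (incr 8)) horizon) m1) 8 0 j.+1 2
      (nth 0 (size w :: w) i.+1)
      = if nth 0 (size w :: w) i.+1 == m1 0 (m1 8 0 + 1) then eval m1 horizon
        else m1 2 (nth 0 (size w :: w) i.+1) by [].
  rewrite tlE m1j addn1 in1; case: eqP => // /eqP ne.
  apply: init1; rewrite ltn_neqAle -ltnS lti andbT.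
  by apply: contraNneq ne => ->.
have m'E : m' = run N (LSet 2 in_s (Defs.Sub (edge_field 9 6) (Const 1)))
    (run N loop m) by rewrite /m' /initialize run_seq.
move: (run N loop m) in1 m16 init m'E => m1 in1 m16 init.
rewrite run_set -[eval _ (Defs.Sub _ _)]/(eval m1 (edge_field 9 6) - 1).
rewrite eval_edge_field // m16 mt /in_s /= in1 => m'E; clearbody m'.
have m'2 x : m' 2 x = if x == code s then t - 1 else m1 2 x by rewrite m'E.
have init_v v : v \in vset G -> m1 2 (code v) = t + l.
  by case/mem_vertex=> j ltj <-; exact: init.
split=> [|v vG|v vG /negPf vs]; rewrite m'2 ?eqxx // (inj_eq (@code_inj T)).
  by case: eqP => _; rewrite ?init_v //; lia.
by rewrite vs init_v // ltnn.
Qed.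

Lemma search_spec X m : s \in vset G -> holds_input m -> holds_removed X m ->
  (forall e, e \in eset H
     = [&& e \in eset G, esrc e \notin X & etgt e \notin X]) ->
  nth 0 (size w :: w) (#|vset G| + 9 + (m 6 0 + m 6 0 + m 6 0)) = t ->
  let m' := run N search m in
  labelling (m' 2) (m' 3) /\ reached_by N (m' 2).
Proof.
move=> sG in_m del edges mt m'.
pose I j m' := [/\ holds_input m', holds_removed X m',
  labelling (m' 2) (m' 3) & reached_by j (m' 2)].
suff: I N m' by case.
rewrite /m' /search run_seq.
have in1 : holds_input (run N initialize m).
  by move=> x; rewrite -in_m run_frame.
have del1 : holds_removed X (run N initialize m).
  by move=> v; rewrite -del run_frame.
have := initialize_spec sG in_m mt.
move: (run N initialize m) in1 del1 => m1 in1 del1 lab1.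
apply: run_for_ind; [by [] | by split |].
move=> j m2 ltj _ [in2 del2 lab2 reach2].
have [lab3 reach3] := relax_loop_spec in2 del2 edges lab2 reach2.
have in3 : holds_input (run N (LFor 10 relax) m2).
  by move=> x; rewrite -in2 run_frame.
have del3 : holds_removed X (run N (LFor 10 relax) m2).
  by move=> v; rewrite -del2 run_frame.
by move: (run _ _ _) in3 del3 lab3 reach3 => m3; split.
Qed.

End Labels.

(** * Backtracking and the whole program *)

Lemma backtrack_spec X m Q : holds_input m -> holds_removed X m ->
  path (fun x y => m 3 (code x) == code y) z (rcons Q s) -> s \notin Q ->
  size Q <= N ->
  let m' := run N backtrack m in
  holds_removed (X :|: [set x in Q]) m'
  /\ output m' = output m ++ map (@code T) Q.
Proof.
move=> in_m del /(pathP s) chain sQ leQN.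
(* The default [s] of [nth] stands for the end of the chain, so [nth s Q j] is the current vertex
   after [j] rounds, also when these exceed [size Q]. *)
have next j : j <= size Q ->
    m 3 (code (nth s (z :: Q) j)) = code (nth s Q j).
  move=> le_j; have := chain j; rewrite size_rcons ltnS => /(_ le_j)/eqP.
  rewrite -rcons_cons !nth_rcons /= ltnS le_j.
  by case: ltnP => // ge_j; rewrite if_same (nth_default s ge_j).
pose J j m' := [/\ holds_input m', m' 3 =1 m 3, m' 5 0 = code (nth s Q j),
  forall v, m' 4 (code v) = (v \in X) || (v \in take j Q)
  & output m' = output m ++ map (@code T) (take j Q)].
suff: J N (run N backtrack m).
  case=> _ _ _ del' out'; rewrite take_oversize // in del' out'.
  by split=> // v; rewrite del' !inE.
rewrite /backtrack run_seq run_set.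
apply: run_for_ind; first by [].
  split=> //; last by rewrite take0 cats0.
    by rewrite -next // -[LHS]/(m 3 (m 0 4)) in_m.
  by move=> v; rewrite take0 in_nil orbF; exact: del.
move=> j m1 ltj _ [in1 m13 m15 del1 out1].
set body := LIf _ _ _.
have bodyE : run N body m1 = if (m1 5 0 == m1 0 3 : nat) != 0 then m1 else
    update (update (update (update m1 1 0 (m1 1 0 + 1)) 1 (m1 1 0 + 1) (m1 5 0))
      4 (m1 5 0) 1) 5 0 (m1 3 (m1 5 0)) by rewrite run_if !run_seq !run_set.
have s3 : m1 0 3 = code s by rewrite in1.
move: bodyE; rewrite s3 m15 (inj_eq (@code_inj T)) eqb0 negbK.
have [ltjQ|geQj] := ltnP j (size Q); last first.
  rewrite nth_default // eqxx => ->; split=> //.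
  - by rewrite nth_default ?leqW // -[LHS]/(m1 5 0) m15 nth_default.
  - move=> v; rewrite take_oversize ?leqW // -[LHS]/(m1 4 (code v)).
    by rewrite del1 take_oversize.
  - rewrite take_oversize ?leqW // -[LHS]/(output m1) out1.
    by rewrite take_oversize.
have /negPf-> : nth s Q j != s.
  by apply: contraNneq sQ => {1}<-; exact: mem_nth.
move=> ->; split=> //.
- by rewrite /update /= m13 -(next j.+1).
- move=> v; rewrite (take_nth s ltjQ) mem_rcons inE /update /=.
  by rewrite (inj_eq (@code_inj T)) del1; case: eqP; rewrite ?orbT.
- rewrite (take_nth s ltjQ) map_rcons -rcons_cat -out1.
  exact: output_rcons.
Qed.

(** Vertices are output in the order of backtracking, hence the permutation. *)
Definition represents m k X H : Prop :=
  [/\ holds_input m, holds_removed X m,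
      greedy_steps s z l k (set0, G) (X, H)
    & exists2 r, output m = map (@code T) r & perm_eq r (enum X)].

(** If the label of [z] is below [t + l], backtracking performs a greedy step. Otherwise no path
    starts at time [t], since by [reached_by] its arrival time would bound that label. *)
Lemma attempt_spec m k X H :
  s \in vset G -> z \in vset G -> s != z -> represents m k X H ->
  let t := nth 0 (size w :: w) (#|vset G| + 9 + (m 6 0 + m 6 0 + m 6 0)) in
  let m' := run N attempt m in
  (represents m' k X H
   /\ forall e P, strict_ltpath l H s z (e :: P) -> etime e <> t)
  \/ exists X' H', represents m' k.+1 X' H' /\ {subset eset H' <= eset H}.
Proof.
move=> sG zG sz [in_m del steps [r out perm_r]] t m'.
have [_ /= edges _ _] := greedy_inv_steps steps.
have HG : {subset eset H <= eset G} by move=> e; rewrite edges => /and3P[].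
have [] := search_spec HG sG in_m del edges (erefl t).
set m1 := run N search m => lab reach.
have in1 : holds_input m1 by move=> x; rewrite -in_m [LHS]run_frame.
have del1 : holds_removed X m1 by move=> v; rewrite -del [LHS]run_frame.
have out1 : output m1 = map (@code T) r.
  rewrite -out /output [m1 1 0]run_frame //.
  by apply: eq_map => i; exact: run_frame.
have horizonE : eval m1 horizon = t + l.
  by rewrite eval_horizon // [m1 6 0]run_frame.
have : m' = if eval m1 (Lt (Get 2 in_z) horizon) != 0
  then run N backtrack m1 else m1 by rewrite /m' /attempt run_seq run_if.
rewrite -[eval m1 (Lt _ _)]/(m1 2 (m1 0 4) < eval m1 horizon : nat).
rewrite horizonE in1 -[nth _ _ 4]/(code z) eqb0 negbK; clearbody m' m1.
have [lt_z ->|ge_z ->] := ltnP; [right | left].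
  have [P [Q [ltP intP uniqQ sQ chain]]] := labelling_ltpath HG lab zG sz lt_z.
  (* The vertices of [Q] lie on a path of the current graph, so they were not output before. *)
  have QX x : x \in Q -> (x \in vset G) && (x \notin X).
    move=> xQ; have : x \in interior s z P by rewrite intP inE.
    by rewrite in_setD => /andP[_]; exact: path_vset_avoid ltP.
  have leQN : size Q <= N.
    apply: leq_trans (_ : #|vset G| <= N); last by rewrite size_encode; lia.
    rewrite -(card_uniqP uniqQ); apply/subset_leq_card/subsetP=> x.
    by case/QX/andP.
  have [del2 out2] := backtrack_spec in1 del1 chain sQ leQN.
  exists (X :|: interior s z P), (remove H (interior s z P)); split; last first.
    by move=> e; rewrite mem_eset_remove => /andP[].
  split.
  - by move=> x; rewrite -in1 run_frame.
  - by rewrite intP.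
  - by apply: greedy_steps_rcons steps _; exists P.
  exists (r ++ Q); first by rewrite out2 out1 map_cat.
  apply: uniq_perm => [||x]; rewrite ?enum_uniq //.
    rewrite cat_uniq (perm_uniq perm_r) enum_uniq uniqQ andbT /=.
    by apply/hasPn=> x /QX/andP[_]; rewrite (perm_mem perm_r) mem_enum.
  by rewrite mem_cat (perm_mem perm_r) !mem_enum inE intP inE.
split=> [|e P ltP te]; first by split=> //; exists r.
have edgesP := strict_ltpath_eset ltP.
case/andP: ltP => /and5P[_ /eqP es /eqP ez conP /andP[_ uniq_tgt]] time.
move: ge_z; rewrite leqNgt => /negP; apply; rewrite -ez.
apply: leq_ltn_trans (_ : etime (last e P) < t + l).
  apply: reach => //; first by rewrite te.
  (* Distinct heads make the edges of the path distinct, so [N] rounds suffice to cover it. *)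
  rewrite -/(size (e :: P)) -(card_uniqP (map_uniq uniq_tgt)).
  apply: leq_trans (_ : #|eset G| <= N); last by rewrite size_encode; lia.
  by apply/subset_leq_card/subsetP=> f /edgesP/HG.
by move: time; rewrite /travel_time te; lia.
Qed.

Lemma greedy_spec : instance G s z l ->
  let m := run N greedy (init_memory w) in
  exists2 X, greedy_returns G s z l X
           & perm_eq (output m) (map (@code T) (enum X)).
Proof.
move=> inst m; have [sG zG sz _ _] := inst.
(* Invariant of the outer loop: the first [j] listed edges start no path any more. At [N] this
   covers all edges of [G]. *)
pose quiet j H := forall e P i,
  strict_ltpath l H s z (e :: P) -> i < j -> ~ edge_at i e.
have quiet_sub j H H' : {subset eset H' <= eset H} -> quiet j H -> quiet j H'.
  by move=> sub q e P i /(strict_ltpath_sub sub); exact: q.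
pose I j m := exists k X H, represents m k X H /\ quiet j H.
suff: I N m.
  case=> k [X [H [[_ _ steps [r -> perm_r]] q]]].
  exists X; last exact: perm_map.
  exists k, H; split=> // -[|e P] //; apply/negP=> ltP.
  have [_ /= edges _ _] := greedy_inv_steps steps.
  have := strict_ltpath_eset ltP (mem_head e P).
  by rewrite edges => /andP[/mem_edge_at[j ltj /(q e P j ltP ltj)]].
rewrite /m /greedy; apply: run_for_ind; first by [].
  exists 0, set0, G; split; last by [].
  split=> [//|v||]; [by rewrite inE | by [] |].
  by exists [::]; rewrite ?enum_set0.
move=> j m0 ltj m0j [k0 [X0 [H0 [rep0 q0]]]].
pose t := nth 0 (size w :: w) (#|vset G| + 9 + (j + j + j)).
(* After [i] attempts at the same [t], either at least [i] greedy steps have been made or an attempt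
   has failed, and then paths starting at [t] never reappear. *)
pose K i m := m 6 0 = j /\ exists k X H,
  [/\ represents m k X H, quiet j H
    & i <= k \/ forall e P, strict_ltpath l H s z (e :: P) -> etime e <> t].
have : K N (run N (LFor 7 attempt) m0); last first.
  move: (run _ _ _) => m1 [_ [k [X [H [rep q done]]]]].
  exists k, X, H; split; first exact: rep.
  have [_ _ steps _] := rep.
  have nopath e P : strict_ltpath l H s z (e :: P) -> etime e <> t.
    (* [N] greedy steps are impossible, as [N] exceeds the number of vertices. *)
    case: done => [leNk|]; last exact.
    have := leq_trans leNk (greedy_steps_bound inst steps).
    by rewrite size_encode; lia.
  move=> e P i ltP; rewrite ltnS leq_eqVlt => /orP[/eqP->|/(q e P i ltP) //].
  by case=> _ _ te; case: (nopath e P ltP).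
apply: run_for_ind; first by [].
  by split=> [//|]; exists k0, X0, H0; split; [exact: rep0 | | left].
move=> i m1 lti _ [m1j [k [X [H [rep q done]]]]].
have m2j : run N attempt m1 6 0 = j by rewrite run_frame.
have := attempt_spec sG zG sz rep.
rewrite m1j; move: (run _ _ _) m2j => m2 m2j spec; split; first exact: m2j.
case: spec => [[rep' nopath]|[X' [H' [rep' sub]]]].
  by exists k, X, H; split; [exact: rep' | | right].
exists k.+1, X', H'; split; [exact: rep' | exact: quiet_sub q |].
case: done => [le_ik|nopath]; [by left | right=> e P].
by move/(strict_ltpath_sub sub); exact: nopath.
Qed.

End Correctness.

(* First part: every execution of the greedy algorithm, whichever paths are
   picked, stops after at most |V| iterations and returns an
   (l-1)-approximation.  Second part: one program executes the algorithm in time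
   polynomial in the bit size of the input. *)
Theorem theorem11 :
  (forall (T : finType) (tau : nat) (G : tgraph T tau) (s z : T) (l : nat),
     instance G s z l ->
     (forall (k : nat) (c : config T tau),
        greedy_steps s z l k (set0, G) c -> k <= #|vset G|) /\
     (forall V' : {set T}, greedy_returns G s z l V' ->
        separator G s z l V' /\
        (forall Vopt : {set T}, min_separator G s z l Vopt ->
           #|V'| <= (l - 1) * #|Vopt|)))
  /\
  (exists (p : com) (q : {poly nat}),
     forall (T : finType) (tau : nat) (G : tgraph T tau) (s z : T) (l : nat),
       instance G s z l ->
       exists (k : nat) (m : memory) (V' : {set T}),
         [/\ exec p (init_memory (encode G s z l)) k m,
             k <= q.[bitsize (encode G s z l)]%R,
             greedy_returns G s z l V'
           & perm_eq (output m) (map (@code T) (enum V'))]).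
Proof.
split=> [T tau G s z l inst|].
  split=> [k c|X]; first exact: greedy_steps_bound.
  exact: greedy_returns_approx.
exists (compile greedy), (cost greedy) => T tau G s z l inst.
have [X ret perm_out] := greedy_spec inst.
set w := encode G s z l in perm_out *.
have [k ex_k le_k] := @exec_run (size w) greedy (init_memory w) isT (erefl _).
exists k, (run (size w) greedy (init_memory w)), X.
split=> //; apply: leq_trans le_k _; exact/leq_cost/size_bitsize.
Qed.
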